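(* Let $m$ be a positive integer and $\lambda$ a nonzero real number. For integers $0\le k\le n$, $$W_{m+1,\lambda}(n,k)=\frac{1}{(m+1)^{k}m^{n-k}}\sum_{j=0}^{n}\binom{n}{j}(-1)^{n-j}(m+1)^{j}\langle 1\rangle_{n-j,m\lambda}\,W_{m,\frac{m}{m+1}\lambda}(j,k),$$ where $W_{m,\mu}(j,k)=0$ for $k>j$.
   Context: For a nonzero real $\mu$: $(x)_{0,\mu}=1$, $(x)_{n,\mu}=x(x-\mu)\cdots(x-(n-1)\mu)$; $\langle x\rangle_{0,\mu}=1$, $\langle x\rangle_{n,\mu}=x(x+\mu)\cdots(x+(n-1)\mu)$; $(x)_n=(x)_{n,1}$. For a positive integer $m$ and nonzero real $\mu$, the degenerate Whitney numbers of the second kind $W_{m,\mu}(n,k)$ are defined by $(mx+1)_{n,\mu}=\sum_{k=0}^{n}W_{m,\mu}(n,k)m^{k}(x)_{k}$. *)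

(* Defs.v *)
From HB Require Import structures.
From mathcomp Require Import all_boot all_order all_algebra.
From mathcomp Require Import ring.
From mathcomp Require Import boolp reals.

Set Implicit Arguments.
Unset Strict Implicit.
Unset Printing Implicit Defensive.

Import Order.TTheory GRing.Theory Num.Theory.
Local Open Scope ring_scope.

(* (x)_{n,mu} = x (x - mu) ... (x - (n-1) mu) *)
Definition gfalling (R : realType) (mu x : R) (n : nat) : R :=
  \prod_(i < n) (x - i%:R * mu).

(* <x>_{n,mu} = x (x + mu) ... (x + (n-1) mu) *)
Definition grising (R : realType) (mu x : R) (n : nat) : R :=
  \prod_(i < n) (x + i%:R * mu).

Definition falling (R : realType) (x : R) (n : nat) : R := gfalling 1 x n.

(* The second clause extends the triangular array to all pairs of indices. *)
Definition is_whitney2 (R : realType) (m : nat) (mu : R)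
    (W : nat -> nat -> R) : Prop :=
  (forall (n : nat) (x : R),
     gfalling mu (m%:R * x + 1) n =
     \sum_(k < n.+1) W n k * m%:R ^+ k * falling x k) /\
  (forall n k : nat, (n < k)%N -> W n k = 0).

(* Only a witness for [whitney2_exists]. *)
Fixpoint whitney2_rec (R : realType) (m : nat) (mu : R) (n k : nat) : R :=
  if n is n'.+1 then
    (if k is k'.+1 then whitney2_rec m mu n' k' else 0)
    + (m%:R * k%:R + 1 - n'%:R * mu) * whitney2_rec m mu n' k
  else (k == 0%N)%:R.

Lemma whitney2_rec_is (R : realType) (m : nat) (mu : R) :
  is_whitney2 m mu (whitney2_rec m mu).
Proof.
have W0 n k : (n < k)%N -> whitney2_rec m mu n k = 0.
  elim: n k => [|n IHn] [|k] //= lt_nk.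
  by rewrite !IHn ?mulr0 ?addr0 // ltnW.
split=> // n x; elim: n => [|n IHn].
  by rewrite big_ord1 /falling /gfalling !big_ord0 !mulr1.
rewrite /gfalling big_ord_recr /= -/(gfalling mu _ n) IHn mulr_suml.
pose c k := m%:R * k%:R + 1 - n%:R * mu.
pose V k := whitney2_rec m mu n k.
transitivity (\sum_(k < n.+2) (if k : nat is k'.+1 then V k' else 0)
                * m%:R ^+ k * falling x k
  + \sum_(k < n.+2) c k * V k * m%:R ^+ k * falling x k); last first.
  by rewrite -big_split /=; apply: eq_bigr => k _; rewrite -!mulrDl.
rewrite [X in _ = X + _]big_ord_recl /= !mul0r add0r.
rewrite [X in _ = _ + X]big_ord_recr /= /V W0 // mulr0 !mul0r addr0.
rewrite -big_split /=; apply: eq_bigr => i _; rewrite /bump /= add1n.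
rewrite /falling {2}/gfalling big_ord_recr /= -/(gfalling 1 x i) exprS /c.
by rewrite mulr1; ring.
Qed.

Lemma whitney2_exists (R : realType) (m : nat) (mu : R) :
  exists W : nat -> nat -> R, is_whitney2 m mu W.
Proof. by exists (whitney2_rec m mu); exact: whitney2_rec_is. Qed.

(* Degenerate Whitney numbers of the second kind: the array satisfying
   [is_whitney2], unique for 0 < m by [whitney2_uniq]. *)
Definition whitney2 (R : realType) (m : nat) (mu : R) : nat -> nat -> R :=
  sval (cid (whitney2_exists m mu)).

Lemma whitney2P (R : realType) (m : nat) (mu : R) :
  is_whitney2 m mu (whitney2 m mu).
Proof. exact: (svalP (cid (whitney2_exists m mu))). Qed.

Lemma whitney2_uniq (R : realType) (m : nat) (mu : R) (W : nat -> nat -> R) :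
  (0 < m)%N -> is_whitney2 m mu W -> W = whitney2 m mu.
Proof.
move=> m_gt0 [defW W0]; have [defV V0] := whitney2P m mu.
apply/funext => n; apply/funext => k.
have [lt_nk|le_kn] := ltnP n k; first by rewrite W0 // V0.
elim/ltn_ind: k le_kn => k IHk le_kn.
have := defW n k%:R; rewrite defV.
have le_kn1 : (k < n.+1)%N by [].
rewrite (bigD1 (Ordinal le_kn1)) // [RHS](bigD1 (Ordinal le_kn1)) //=.
rewrite [X in _ + X = _](eq_bigr
  (fun i : 'I_n.+1 => W n i * m%:R ^+ i * falling k%:R i)); last first.
  move=> i neq_ik; have [lt_ik|lt_ki|eq_ik] := ltngtP i k.
  - by rewrite IHk // -ltnS ltn_ord.
  - rewrite /falling /gfalling (bigD1 (Ordinal lt_ki)) //= mulr1 subrr.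
    by rewrite mul0r !mulr0.
  - by case/eqP: neq_ik; apply/val_inj.
move/addIr; rewrite -!mulrA => /mulIf-> //.
rewrite mulf_neq0 ?expf_neq0 ?pnatr_eq0 -?lt0n //.
rewrite /falling /gfalling; apply/prodf_neq0 => i _.
by rewrite mulr1 subr_eq0 eqr_nat gtn_eqF.
Qed.

(* Main.v *)
(* With y = m (m+1) x + (m+1) and step m lambda, the generating polynomials of
   the two Whitney arrays are, up to powers of m and m+1, the falling
   factorials of y - 1 and of y.  The Vandermonde convolution at y + (-1) thus
   shows that the right-hand side satisfies the identity that characterizes
   [whitney2 m.+1 lambda]. *)
Require Import Defs.
From HB Require Import structures.
From mathcomp Require Import all_boot all_order all_algebra.
From mathcomp Require Import ring.
From mathcomp Require Import reals.

Set Implicit Arguments.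
Unset Strict Implicit.
Unset Printing Implicit Defensive.

Import Order.TTheory GRing.Theory Num.Theory.
Local Open Scope ring_scope.

Lemma gfallingS (R : realType) (mu x : R) (n : nat) :
  gfalling mu x n.+1 = gfalling mu x n * (x - n%:R * mu).
Proof. by rewrite /gfalling big_ord_recr. Qed.

Lemma gfalling_scale (R : realType) (c mu x : R) (n : nat) :
  gfalling (c * mu) (c * x) n = c ^+ n * gfalling mu x n.
Proof.
elim: n => [|n IHn]; first by rewrite /gfalling !big_ord0 mulr1.
by rewrite !gfallingS IHn exprS; ring.
Qed.

(** At [x = 1] this produces the signs and the rising factorials of 1 in the theorem. *)
Lemma gfallingN (R : realType) (mu x : R) (n : nat) :
  gfalling mu (- x) n = (-1) ^+ n * grising mu x n.
Proof.
elim: n => [|n IHn]; first by rewrite /gfalling /grising !big_ord0 mulr1.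
by rewrite gfallingS IHn /grising big_ord_recr exprS /=; ring.
Qed.

(** Induction on [n]: the new factor x + y - n mu splits as (x - j mu) + (y - (n - j) mu), and
    Pascal's rule merges the two resulting sums. *)
Lemma gfallingD (R : realType) (mu x y : R) (n : nat) :
  gfalling mu (x + y) n =
  \sum_(j < n.+1) 'C(n, j)%:R * gfalling mu x j * gfalling mu y (n - j).
Proof.
elim: n => [|n IHn]; first by rewrite big_ord1 /gfalling !big_ord0 !mulr1.
(* The second sum gets an extra term, zero since C(n, n+1) = 0, so that its tail after j = 0 lines
   up with the first sum. *)
transitivity (
    \sum_(j < n.+1) 'C(n, j)%:R * gfalling mu x j.+1 * gfalling mu y (n - j)
  + \sum_(j < n.+2) 'C(n, j)%:R * gfalling mu x j * gfalling mu y (n.+1 - j)).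
  rewrite [X in _ = _ + X]big_ord_recr /= bin_small // !mul0r addr0.
  rewrite -big_split gfallingS IHn mulr_suml; apply: eq_bigr => j _ /=.
  have le_jn : (j <= n)%N by rewrite -ltnS.
  by rewrite subSn // !gfallingS natrB //; ring.
rewrite [X in _ + X]big_ord_recl [RHS]big_ord_recl /= !bin0 addrCA; congr (_ + _).
rewrite -big_split; apply: eq_bigr => j _ /=.
by rewrite /bump /= add1n subSS binS natrD; ring.
Qed.

Theorem theorem21 (R : realType) (m : nat) (lambda : R) (n k : nat)
    (m_gt0 : (0 < m)%N) (lambda_neq0 : lambda != 0) (le_kn : (k <= n)%N) :
  whitney2 m.+1 lambda n k =
  1 / (m.+1%:R ^+ k * m%:R ^+ (n - k)) *
  \sum_(j < n.+1)
     'C(n, j)%:R * (-1) ^+ (n - j) * m.+1%:R ^+ j *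
     grising (m%:R * lambda) 1 (n - j) *
     whitney2 m (m%:R / m.+1%:R * lambda) j k.
Proof.
have m_neq0 : m%:R != 0 :> R by rewrite pnatr_eq0 -lt0n.
have m1_neq0 : m.+1%:R != 0 :> R by rewrite pnatr_eq0.
pose mu := m%:R / m.+1%:R * lambda; have [defW W0] := whitney2P m mu.
pose V n k := 1 / (m.+1%:R ^+ k * m%:R ^+ (n - k)) * \sum_(j < n.+1)
  'C(n, j)%:R * (-1) ^+ (n - j) * m.+1%:R ^+ j *
  grising (m%:R * lambda) 1 (n - j) * whitney2 m mu j k.
suffices /whitney2_uniq <- : is_whitney2 m.+1 lambda V by [].
move=> {n k le_kn}; split=> [n x|n k lt_nk]; last first.
  rewrite /V big1 ?mulr0 // => j _.
  by rewrite W0 ?mulr0 // (leq_ltn_trans _ lt_nk) // -ltnS.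
(* A range of [k] independent of [j] lets the sums be exchanged; the added terms have k > j and
   vanish. *)
have extW (j : 'I_n.+1) : gfalling mu (m%:R * x + 1) j =
    \sum_(k < n.+1) whitney2 m mu j k * m%:R ^+ k * falling x k.
  rewrite defW (big_ord_widen n.+1
    (fun k => whitney2 m mu j k * m%:R ^+ k * falling x k)) //.
  rewrite big_mkcond; apply: eq_bigr => k _ /=.
  by case: ltnP => // lt_jk; rewrite W0 // !mul0r.
(* The factor m^n turns step lambda into step m lambda. *)
apply: (mulfI (expf_neq0 n m_neq0)); rewrite -gfalling_scale.
pose y : R := m.+1%:R * (m%:R * x + 1).
have -> : m%:R * (m.+1%:R * x + 1) = y + - 1 by rewrite /y -natr1; ring.
rewrite gfallingD mulr_sumr.
(* This common step dictates the parameter [mu]: scaling by m+1 brings the second array to it. *)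
have step_eq : m%:R * lambda = m.+1%:R * mu.
  by rewrite /mu mulrA mulrCA mulfV // mulr1.
rewrite step_eq.
under eq_bigr => j _.
  rewrite gfalling_scale gfallingN extW !mulr_sumr mulr_suml.
  over.
rewrite exchange_big; apply: eq_bigr => k _ /=.
have le_kn : (k <= n)%N by rewrite -ltnS.
have -> : m%:R ^+ n * (V n k * m.+1%:R ^+ k * falling x k) =
    (m%:R ^+ k * falling x k) * \sum_(j < n.+1)
      'C(n, j)%:R * (-1) ^+ (n - j) * m.+1%:R ^+ j *
      grising (m%:R * lambda) 1 (n - j) * whitney2 m mu j k.
  (* Since k <= n, m^n = m^k m^(n-k), and the second factor cancels against the denominator in
     [V]. *)
  rewrite /V -{1}(subnKC le_kn) exprD; set S := \sum_(_ < _) _.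
  by field; rewrite !expf_neq0.
rewrite step_eq.
by rewrite mulr_sumr; apply: eq_bigr => j _; ring.
Qed.
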